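(* For $n\geq 4$, $$|\mathcal{AOR}_n|=\begin{cases}1+n\dbinom{2n}{n}-\dfrac{n^2(n^2+1)}{2} & \text{if } n\equiv 1\ (\mathrm{mod}\ 4),\\[2ex] 1+n\dbinom{2n}{n}-\dfrac{n^2(n^2+1)}{2}-n & \text{if } n\not\equiv 1\ (\mathrm{mod}\ 4).\end{cases}$$
   Context: Let $\Omega_n=\{1<2<\cdots<n\}$ and let $\mathcal{I}_n$ be the symmetric inverse monoid on $\Omega_n$, i.e. the monoid of all injective partial maps (partial permutations) of $\Omega_n$ under composition of partial maps. The alternating inverse monoid is $\mathcal{AI}_n=\{\alpha\in\mathcal{I}_n : \alpha=\sigma|_{\mathrm{Dom}(\alpha)}\text{ for some even permutation }\sigma\text{ of }\Omega_n\}$. A partial permutation $\alpha$ with $\mathrm{Dom}(\alpha)=\{a_1<\cdots<a_t\}$, $t\geq 0$, is orientation-preserving [respectively, orientation-reversing] if there is at most one index $i\in\{1,\ldots,t\}$ with $a_i\alpha>a_{i+1}\alpha$ [respectively, $a_i\alpha<a_{i+1}\alpha$], where $a_{t+1}$ denotes $a_1$; it is oriented if it is orientation-preserving or orientation-reversing. $\mathcal{AOR}_n$ is the inverse submonoid of $\mathcal{I}_n$ of all oriented elements of $\mathcal{AI}_n$. *)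

(* Defs.v *)
From mathcomp Require Import all_boot all_order all_fingroup all_algebra.

Set Implicit Arguments.
Unset Strict Implicit.
Unset Printing Implicit Defensive.

(* The chain {1 < ... < n} is 'I_n. A partial map a of 'I_n is an option-valued
   finite function, with a x = None when a is undefined at x. *)
Definition pmap_on (n : nat) := {ffun 'I_n -> option 'I_n}.

Definition pdom (n : nat) (a : pmap_on n) : {set 'I_n} := [set x | a x != None].

Definition sym_inv (n : nat) : {set pmap_on n} :=
  [set a : pmap_on n | [forall x in pdom a, forall y in pdom a,
                          (a x == a y) ==> (x == y)]].

Definition alt_inv (n : nat) : {set pmap_on n} :=
  [set a in sym_inv n | [exists s : 'S_n,
     ~~ odd_perm s && [forall x in pdom a, a x == Some (s x)]]].

(* The sequence a_1 alpha, ..., a_t alpha, where a_1 < ... < a_t are the elements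
   of the domain: [enum] lists a subset of 'I_n in increasing order. *)
Definition images (n : nat) (a : pmap_on n) : seq nat :=
  [seq val y | y <- pmap a (enum (pdom a))].

(* The number of indices i of s with r s_i s_(i+1), indices being cyclic. *)
Definition cyclic_count (r : rel nat) (s : seq nat) : nat :=
  #|[set i : 'I_(size s) | r (nth 0 s i) (nth 0 s (i.+1 %% size s))]|.

Definition orientation_preserving (n : nat) (a : pmap_on n) : bool :=
  cyclic_count (fun x y => y < x) (images a) <= 1.

Definition orientation_reversing (n : nat) (a : pmap_on n) : bool :=
  cyclic_count (fun x y => x < y) (images a) <= 1.

Definition oriented (n : nat) (a : pmap_on n) : bool :=
  orientation_preserving a || orientation_reversing a.

Definition AOR (n : nat) : {set pmap_on n} := [set a in alt_inv n | oriented a].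

(* Main.v *)
Require Import Defs.
From mathcomp Require Import all_boot all_order all_fingroup all_algebra.
From mathcomp Require Import cyclic zify ring lra.
Import GRing.Theory Num.Theory.

Set Implicit Arguments.
Unset Strict Implicit.

(* A partial permutation of rank t is determined by its domain A, its image B and
   the permutation p of 'I_t that it induces through the increasing enumerations
   of A and B, and it is oriented iff p lies in the dihedral group of 'I_t, which
   has 2t elements for t > 2 and t! elements otherwise.
   In rank at most n - 2 every partial permutation extends to an even permutation,
   since one can compose an extension with a transposition of two points outside
   the domain.  In rank n - 1, with i and j the points missing from the domain and
   the image, the extension is unique, of parity i + j + (parity of p); one of the
   sign-reversing bijections i |-> n - 1 - i and p |-> (rotation) * p exists
   according to the parity of n, so exactly half of the oriented elements are
   alternating.  In rank n one counts the even elements of the dihedral group.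
   The sum is evaluated with sum_t 2t C(n,t)^2 = n C(2n,n). *)

(** * Cyclic descents and ascents of words *)

(** Zipping a word with its rotation by one lists the cyclically adjacent pairs, so that induction
    and permutation arguments for [count] apply. *)
Lemma cyclic_count_zip (r : rel nat) (s : seq nat) :
  cyclic_count r s = count (fun p => r p.1 p.2) (zip s (rot 1 s)).
Proof.
have -> : zip s (rot 1 s) =
    [seq (nth 0 s i, nth 0 s (i.+1 %% size s)) | i : 'I_(size s) <- enum 'I_(size s)].
  apply: (@eq_from_nth _ (0, 0)) => [|k].
    by rewrite size_zip size_rot minnn size_map size_enum_ord.
  rewrite size_zip size_rot minnn => lt_ks.
  rewrite nth_zip ?size_rot // (nth_map (Ordinal lt_ks)) ?size_enum_ord //.
  rewrite nth_enum_ord //; congr (_, _).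
  case: s lt_ks => // x s lt_ks; rewrite rot1_cons nth_rcons.
  have [lt_k | eq_k] : k < size s \/ k = size s by move: lt_ks => /=; lia.
    by rewrite lt_k modn_small.
  by rewrite eq_k ltnn eqxx modnn.
rewrite count_map /cyclic_count cardsE cardE -size_filter; congr size.
by rewrite enumT.
Qed.

(** Rotating the word rotates its list of cyclically adjacent pairs, and [count] ignores the
    order. *)
Lemma cyclic_count_rot (r : rel nat) (k : nat) (s : seq nat) :
  cyclic_count r (rot k s) = cyclic_count r s.
Proof.
have zipr : zip (rot k s) (rot k (rot 1 s)) = rot k (zip s (rot 1 s)).
  rewrite /rot zip_cat ?size_drop ?size_rot //.
  have zd (a b : seq nat) j : zip (drop j a) (drop j b) = drop j (zip a b).
    by elim: j a b => [|j IH] [|x a] [|y b] //=; rewrite ?drop0 //; case: (drop _ _).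
  have zt (a b : seq nat) j : zip (take j a) (take j b) = take j (zip a b).
    by elim: j a b => [|j IH] [|x a] [|y b] //=; rewrite ?take0 //= ?IH //; case: (take _ _).
  by rewrite zd zt.
rewrite !cyclic_count_zip rot_rot zipr.
by apply/seq.permP; rewrite perm_rot.
Qed.

Lemma cyclic_count_map (r r' : rel nat) (f : nat -> nat) (s : seq nat) :
  {in s &, forall x y, r (f x) (f y) = r' x y} ->
  cyclic_count r (map f s) = cyclic_count r' s.
Proof.
move=> rf; rewrite /cyclic_count size_map; apply: eq_card => i; rewrite !inE.
have lt_S : i.+1 %% size s < size s by rewrite ltn_mod (leq_trans _ (ltn_ord i)).
by rewrite !(nth_map 0) // rf ?mem_nth.
Qed.

Lemma cyclic_count_le (r : rel nat) (s : seq nat) : cyclic_count r s <= size s.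
Proof. by rewrite -[leqRHS]card_ord max_card. Qed.

(** Cyclic neighbours occupy distinct positions once the size exceeds 1, so in a duplicate-free word
    each index is either a descent or an ascent. *)
Lemma cyclic_count_compl (s : seq nat) : uniq s -> 1 < size s ->
  cyclic_count (fun x y => y < x) s + cyclic_count (fun x y => x < y) s = size s.
Proof.
move=> s_uniq s_gt1; rewrite /cyclic_count -[RHS]card_ord.
rewrite -[RHS](cardsC [set i : 'I_(size s) | nth 0 s (i.+1 %% size s) < nth 0 s i]).
congr (_ + _); apply: eq_card => i; rewrite !inE -leqNgt ltn_neqAle.
have lt_S : i.+1 %% size s < size s by rewrite ltn_mod (leq_trans _ s_gt1).
rewrite nth_uniq // neq_ltn.
have lt_is := ltn_ord i.
have [lt_k | eq_k] : i.+1 < size s \/ i.+1 = size s by lia.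
  by rewrite modn_small // ltnSn.
by rewrite eq_k modnn; case: (val i) eq_k => [|j] /=; rewrite ?orbT //; lia.
Qed.

(** Isolates the closing pair of the cycle: for [y := x] the last summand is the wrap-around
    descent. *)
Lemma count_descents_cons (x y : nat) (s : seq nat) :
  count (fun p => p.2 < p.1) (zip (x :: s) (rcons s y)) =
  count (fun p => p.2 < p.1) (zip (x :: s) s) + (y < last x s).
Proof.
elim: s x => [|z s IH] x /=; first by rewrite addn0.
by rewrite -/(zip (z :: s) (rcons s y)) IH addnA.
Qed.

Lemma no_descents_path (x : nat) (s : seq nat) :
  (count (fun p => p.2 < p.1) (zip (x :: s) s) == 0) = path leq x s.
Proof.
elim: s x => [|z s IH] x //.
by rewrite [zip _ _]/= [count _ _]/= addn_eq0 IH /= eqb0 -leqNgt.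
Qed.

Lemma cyclic_descents_rot_iota (k t : nat) :
  cyclic_count (fun x y => y < x) (rot k (iota 0 t)) <= 1.
Proof.
rewrite cyclic_count_rot; case: t => [|t].
  by apply: leq_trans (cyclic_count_le _ _) _.
rewrite cyclic_count_zip rot1_cons count_descents_cons.
have /eqP -> : count (fun p => p.2 < p.1) (zip (0 :: iota 1 t) (iota 1 t)) == 0.
  by rewrite no_descents_path; exact: (iota_sorted 0 t.+1).
by case: (_ < _).
Qed.

(** Rotate the word until it starts with 0. If it has further letters, the return from the last one
    to 0 is the single allowed descent, so the rotated word increases and is [iota 0 t]. *)
Lemma cyclic_descents_le1 (t : nat) (s : seq nat) :
  perm_eq s (iota 0 t) -> cyclic_count (fun x y => y < x) s <= 1 ->
  exists k, s = rot k (iota 0 t).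
Proof.
case: t => [|t] s_iota; first by move/perm_nilP: s_iota => ->; exists 0.
move=> s_le1; have s0 : 0 \in s by rewrite (perm_mem s_iota) mem_iota.
pose u := rot (index 0 s) s.
suff u_iota : u = iota 0 t.+1.
  (* This amount undoes the rotation that brought 0 to the front. *)
  by exists (size u - index 0 s); rewrite -u_iota -/(rotr _ u) rotK.
have u_perm : perm_eq u (iota 0 t.+1) by rewrite perm_rot.
apply: (sorted_eq leq_trans anti_leq _ (iota_sorted _ _) u_perm).
move: s_le1 u_perm; rewrite -(cyclic_count_rot _ (index 0 s)) -/u.
have [v ->] : exists v, u = 0 :: v.
  exists (drop (index 0 s).+1 s ++ take (index 0 s) s).
  by rewrite /u /rot (drop_nth 0) ?index_mem //= nth_index.
rewrite cyclic_count_zip rot1_cons count_descents_cons /= => v_le1 v_perm.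
rewrite -no_descents_path; case: v v_le1 v_perm => // z v v_le1 v_perm.
have v_uniq : uniq (0 :: z :: v) by rewrite (perm_uniq v_perm); exact: (iota_uniq 0 t.+1).
(* 0 already stands at the front, so a duplicate-free word cannot also end with it. *)
have : 0 < last 0 (z :: v).
  rewrite lt0n; apply: contraTneq v_uniq => last0.
  by have := mem_last z v; rewrite -[last z v]/(last 0 (z :: v)) last0 cons_uniq => ->.
by move=> last_gt0; rewrite last_gt0 in v_le1; lia.
Qed.

(** * Words of permutations and the dihedral group *)

Definition perm_word (t : nat) (p : 'S_t) : seq nat :=
  [seq val (p k) | k <- enum 'I_t].

Lemma size_perm_word (t : nat) (p : 'S_t) : size (perm_word p) = t.
Proof. by rewrite size_map size_enum_ord. Qed.

Lemma nth_perm_word (t : nat) (p : 'S_t) (k : 'I_t) : nth 0 (perm_word p) k = p k.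
Proof. by rewrite (nth_map k) ?size_enum_ord // nth_ord_enum. Qed.

Lemma perm_word_inj (t : nat) : injective (@perm_word t).
Proof.
move=> p q eq_pq; apply/permP => k; apply: val_inj.
by rewrite /= -!nth_perm_word eq_pq.
Qed.

Lemma perm_word_uniq (t : nat) (p : 'S_t) : uniq (perm_word p).
Proof. by rewrite map_inj_uniq ?enum_uniq // => i j /val_inj/perm_inj. Qed.

Lemma mem_perm_word (t : nat) (p : 'S_t) : perm_word p =i iota 0 t.
Proof.
apply: (uniq_min_size (perm_word_uniq p) _ _).2 => [k /mapP[j _ ->]|].
  by rewrite mem_iota /=.
by rewrite size_iota size_perm_word.
Qed.

Lemma perm_word_iota (t : nat) (p : 'S_t) : perm_eq (perm_word p) (iota 0 t).
Proof. exact: uniq_perm (perm_word_uniq p) (iota_uniq _ _) (mem_perm_word p). Qed.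

Definition oriented_word (s : seq nat) : bool :=
  (cyclic_count (fun x y => y < x) s <= 1) || (cyclic_count (fun x y => x < y) s <= 1).

(** The cycle sending [i] to [i + 1] modulo [t]; the form [lift_perm] makes its parity immediate
    from [odd_lift_perm]. *)
Definition rotation (t : nat) : 'S_t :=
  if t is t'.+1 then lift_perm ord_max ord0 1 else 1.

Definition reflection (t : nat) : 'S_t := perm (@rev_ord_inj t).

(** The two cosets match the orientation-preserving and orientation-reversing cases; they coincide
    for [t <= 2]. *)
Definition dihedral (t : nat) : {set 'S_t} :=
  (<[rotation t]> :|: <[rotation t]> :* reflection t)%g.

Lemma rotationE (t : nat) (i : 'I_t) : rotation t i = i.+1 %% t :> nat.
Proof.
case: t i => [[]|t i] //=.
case: (unliftP ord_max i) => [j ->|->].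
  by rewrite lift_perm_lift perm1 /= /bump leq0n leqNgt ltn_ord modn_small //= ltnS ltn_ord.
by rewrite lift_perm_id modnn.
Qed.

Lemma rotation_expE (t k : nat) (i : 'I_t) : (rotation t ^+ k)%g i = (i + k) %% t :> nat.
Proof.
elim: k => [|k IH]; first by rewrite expg0 perm1 addn0 modn_small.
by rewrite expgSr permM rotationE IH -addn1 modnDml addn1 addnS.
Qed.

Lemma order_rotation (t : nat) : 0 < t -> #[rotation t]%g = t.
Proof.
move=> t_gt0; apply/eqP; rewrite eqn_dvd order_dvdn; apply/andP; split.
  by apply/eqP/permP => i; apply: val_inj; rewrite /= rotation_expE perm1 modnDr modn_small.
have := rotation_expE #[rotation t]%g (Ordinal t_gt0).
by rewrite expg_order perm1 add0n /= => /esym/eqP.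
Qed.

Lemma perm_word_rotation_exp (t k : nat) : k <= t ->
  perm_word (rotation t ^+ k)%g = rot k (iota 0 t).
Proof.
move=> le_kt; apply: (@eq_from_nth _ 0) => [|i].
  by rewrite size_perm_word size_rot size_iota.
rewrite size_perm_word => lt_it; rewrite (nth_perm_word _ (Ordinal lt_it)) rotation_expE /=.
rewrite /rot nth_cat size_drop size_iota drop_iota take_iota.
case: ltnP => [lt_i|le_i].
  by rewrite nth_iota // modn_small; lia.
rewrite nth_iota; last by lia.
have -> : i + k = (i + k - t) + t by lia.
by rewrite modnDr modn_small; lia.
Qed.

Lemma cyclic_descents_perm (t : nat) (p : 'S_t) :
  (cyclic_count (fun x y => y < x) (perm_word p) <= 1) = (p \in <[rotation t]>%g).
Proof.
apply/idP/cycleP => [|[k ->]].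
  move=> /(cyclic_descents_le1 (perm_word_iota p))[k p_rot].
  (* [rot k] is the identity for [k] beyond the length, hence the exponent 0 there. *)
  exists (if k <= t then k else 0); apply: perm_word_inj.
  rewrite perm_word_rotation_exp; last by case: ifP.
  rewrite p_rot; case: ifP => // /negbT; rewrite -ltnNge => lt_tk.
  by rewrite rot_oversize ?rot0 // size_iota ltnW.
case: (posnP t) => [t0|t_gt0].
  by apply: leq_trans (cyclic_count_le _ _) _; rewrite size_perm_word t0.
rewrite -expg_mod_order order_rotation // perm_word_rotation_exp.
  exact: cyclic_descents_rot_iota.
by rewrite ltnW ?ltn_mod.
Qed.

(** Following [p] by the reflection replaces each value [j] by [t - j.+1], which exchanges ascents
    and descents. *)
Lemma cyclic_ascents_perm (t : nat) (p : 'S_t) :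
  (cyclic_count (fun x y => x < y) (perm_word p) <= 1) =
  (p \in <[rotation t]> :* reflection t)%g.
Proof.
have reflV : (reflection t)^-1%g = reflection t.
  apply: (mulgI (reflection t)); rewrite mulgV.
  by apply/permP => i; rewrite permM !permE rev_ordK.
rewrite mem_rcoset reflV -cyclic_descents_perm.
have -> : perm_word (p * reflection t)%g = map (fun j => t - j.+1) (perm_word p).
  by rewrite -map_comp; apply: eq_map => i /=; rewrite permM permE.
rewrite (@cyclic_count_map _ (fun x y => x < y)) // => x y.
by rewrite !mem_perm_word !mem_iota /= => lt_xt lt_yt; lia.
Qed.

Lemma oriented_word_perm (t : nat) (p : 'S_t) :
  oriented_word (perm_word p) = (p \in dihedral t).
Proof. by rewrite in_setU -cyclic_descents_perm -cyclic_ascents_perm. Qed.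

(** A common element would have at most one descent and at most one ascent, while these numbers add
    up to [t > 2]. *)
Lemma dihedral_disjoint (t : nat) : 2 < t ->
  [disjoint <[rotation t]>%g & (<[rotation t]> :* reflection t)%g].
Proof.
move=> t_gt2; rewrite -setI_eq0; apply/eqP/setP => p; rewrite !inE.
rewrite -cyclic_descents_perm -cyclic_ascents_perm.
have := cyclic_count_compl (perm_word_uniq p); rewrite size_perm_word.
by move=> /(_ (ltnW t_gt2)) count_sum; lia.
Qed.

Lemma card_dihedral (t : nat) : 2 < t -> #|dihedral t| = 2 * t.
Proof.
move=> t_gt2; have t_gt0 : 0 < t by lia.
rewrite cardsU (eqP (_ : _ :&: _ == set0)) ?setI_eq0 ?dihedral_disjoint //.
by rewrite cards0 subn0 card_rcoset -orderE order_rotation // mul2n addnn.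
Qed.

(** Every permutation qualifies: descents and ascents together number at most 2, unless [t <= 1],
    where the length alone bounds them. *)
Lemma card_dihedral_small (t : nat) : t <= 2 -> #|dihedral t| = t`!.
Proof.
move=> t_le2; rewrite -card_Sn; apply: eq_card => p; rewrite -oriented_word_perm inE.
have := cyclic_count_compl (perm_word_uniq p); rewrite size_perm_word /oriented_word.
have := cyclic_count_le (fun x y => x < y) (perm_word p); rewrite size_perm_word.
by case: ltnP => [_ _ /(_ isT)|le_t1 le_count _]; lia.
Qed.

(** * Parity in the dihedral group *)

Lemma odd_rotation (t : nat) : 0 < t -> odd_perm (rotation t) = ~~ odd t.
Proof. by case: t => // t _; rewrite odd_lift_perm odd_perm1 !addbF /= negbK. Qed.

(** Removing the pair sending 0 to the maximum leaves a smaller reflection and changes the parity by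
    that of [t], as in Pascal's rule. *)
Lemma odd_reflection (t : nat) : odd_perm (reflection t) = odd 'C(t, 2).
Proof.
elim: t => [|t IH].
  by rewrite (_ : reflection 0 = 1%g) ?odd_perm1 //; apply/permP => -[].
have -> : reflection t.+1 = lift_perm ord0 ord_max (reflection t).
  apply/permP => i; rewrite permE; case: (unliftP ord0 i) => [j ->|->].
    rewrite lift_perm_lift permE; apply: val_inj => /=.
    by rewrite /bump leq0n; have := ltn_ord j; case: leqP; lia.
  by rewrite lift_perm_id; apply: val_inj; rewrite /= subn1.
by rewrite odd_lift_perm IH binS bin1 oddD /=; case: (odd t); case: (odd _).
Qed.

(** [f] injects each of the two classes of [b] into the other, so they are equinumerous. *)
Lemma card_sign_halves (T : finType) (X : {set T}) (b : pred T) (f : T -> T) :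
  injective f -> {in X, forall x, f x \in X} -> {in X, forall x, b (f x) = ~~ b x} ->
  2 * #|[set x in X | b x]| = #|X|.
Proof.
move=> f_inj fX bf.
have le_card (c : bool) : #|[set x in X | b x == c]| <= #|[set x in X | b x == ~~ c]|.
  rewrite -(card_imset _ f_inj); apply/subset_leq_card/subsetP => _ /imsetP[x + ->].
  by rewrite !inE => /andP[xX /eqP <-]; rewrite fX ?bf //=.
rewrite -(cardsID [set x in X | b x] X) mul2n -addnn.
have -> : X :&: [set x in X | b x] = [set x in X | b x == true].
  by apply/setP => x; rewrite !inE eqb_id; case: (x \in X).
have -> : X :\: [set x in X | b x] = [set x in X | b x == false].
  by apply/setP => x; rewrite !inE eqbF_neg andbC; case: (x \in X).
have -> : [set x in X | b x] = [set x in X | b x == true].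
  by apply/setP => x; rewrite !inE eqb_id.
by have := le_card true; have := le_card false => /=; lia.
Qed.

Lemma mulg_rotation_dihedral (t : nat) (p : 'S_t) :
  p \in dihedral t -> (rotation t * p)%g \in dihedral t.
Proof.
by rewrite !in_setU !mem_rcoset -mulgA !(groupMl _ (cycle_id _)).
Qed.

(** For even [t] the rotation is odd and multiplying by it swaps parities. For odd [t] all rotations
    are even, and all reflections share the parity of ['C(t, 2)], which is even exactly when [t] is
    1 modulo 4. *)
Lemma card_even_dihedral (t : nat) : 2 < t ->
  #|[set p in dihedral t | ~~ odd_perm p]| = if t %% 4 == 1 then 2 * t else t.
Proof.
move=> t_gt2; have t_gt0 : 0 < t by lia.
have [t_odd | t_even] := boolP (odd t); last first.
  have := @card_sign_halves _ (dihedral t) (fun p => ~~ odd_perm p) (mulg (rotation t)).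
  rewrite card_dihedral // => /(_ (mulgI _) (@mulg_rotation_dihedral t)) half.
  have /half : {in dihedral t, forall p, ~~ odd_perm (rotation t * p)%g = ~~ ~~ odd_perm p}.
    by move=> p _; rewrite odd_permM odd_rotation // t_even addTb.
  by have -> : (t %% 4 == 1) = false; lia.
have even_rot p : p \in <[rotation t]>%g -> odd_perm p = false.
  case/cycleP=> k ->; elim: k => [|k IH]; first by rewrite expg0 odd_perm1.
  by rewrite expgS odd_permM odd_rotation // t_odd IH.
have odd_C : odd 'C(t, 2) = (t %% 4 != 1).
  by rewrite bin2odd // oddM t_odd; lia.
have odd_refl p : p \in (<[rotation t]> :* reflection t)%g -> odd_perm p = (t %% 4 != 1).
  rewrite mem_rcoset => /even_rot; rewrite odd_permM odd_permV odd_reflection odd_C.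
  by case: odd_perm; case: (_ != _).
case: ifP odd_refl => [_|_] odd_refl /=.
  rewrite -card_dihedral //; apply: eq_card => p; rewrite !inE.
  by case: (boolP (p \in _)) => [/even_rot -> //|_] /=; case: (boolP (p \in _)) => // /odd_refl ->.
rewrite -[RHS]order_rotation // orderE; apply: eq_card => p; rewrite !inE.
case: (boolP (p \in <[rotation t]>%g)) => [/even_rot -> //|_] /=.
by case: (boolP (p \in _)) => // /odd_refl ->.
Qed.

(** * Partial permutations as triples of domain, image and induced permutation *)

Lemma enum_ord_ltn_sorted (n : nat) (A : {set 'I_n}) :
  sorted ltn [seq val x | x <- enum A].
Proof.
have -> : enum A = [seq x <- enum 'I_n | x \in A] by rewrite enumT.
rewrite sorted_map; apply: sorted_filter => [x y z|]; first exact: ltn_trans.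
by rewrite -sorted_map val_enum_ord iota_ltn_sorted.
Qed.

Lemma nth_enum_ltn (n : nat) (x0 : 'I_n) (A : {set 'I_n}) (i j : nat) :
  i < #|A| -> j < #|A| -> (nth x0 (enum A) i < nth x0 (enum A) j) = (i < j).
Proof.
rewrite cardE => lt_i lt_j.
have homo k l : k < l < size (enum A) -> nth x0 (enum A) k < nth x0 (enum A) l.
  move=> /andP[lt_kl lt_l]; have lt_k := ltn_trans lt_kl lt_l.
  have := sorted_ltn_nth ltn_trans 0 (enum_ord_ltn_sorted A) => /(_ k l).
  by rewrite !inE size_map !(nth_map x0) // => /(_ lt_k lt_l lt_kl).
case: (ltngtP i j) => [lt_ij|lt_ji|->]; last by rewrite ltnn.
  by rewrite homo // lt_ij.
by apply: negbTE; rewrite -leqNgt ltnW // homo // lt_ji.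
Qed.

Lemma sym_inv_fun (n : nat) (x0 : 'I_n) (a : pmap_on n) : a \in sym_inv n ->
  exists2 g : 'I_n -> 'I_n,
    {in pdom a &, injective g} & {in pdom a, forall x, a x = Some (g x)}.
Proof.
move=> a_inj; pose g x := odflt x0 (a x).
have aE : {in pdom a, forall x, a x = Some (g x)}.
  by move=> x; rewrite inE /g; case: (a x).
exists g => // x y xA yA eq_g; move: a_inj; rewrite inE.
move=> /forall_inP/(_ x xA)/forall_inP/(_ y yA)/implyP.
by rewrite !aE // eq_g eqxx => /(_ isT)/eqP.
Qed.

Section MakePmap.
Variables (n t : nat) (x0 : 'I_n).
Implicit Types (A B : {set 'I_n}) (p : 'S_t).

(* The partial map sending the k-th smallest element of A to the p(k)-th smallest
   element of B. *)
Definition mk_pmap A B p : pmap_on n :=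
  [ffun x => omap (fun k : 'I_t => nth x0 (enum B) (p k))
                  [pick k : 'I_t | nth x0 (enum A) k == x]].

Lemma enum_nth_ord A : #|A| = t -> enum A = [seq nth x0 (enum A) (val k) | k <- enum 'I_t].
Proof.
move=> At; rewrite (map_comp (nth x0 (enum A)) val) val_enum_ord.
by rewrite map_nth_iota0 -?cardE ?At // -At cardE take_size.
Qed.

Lemma mem_nth_ord A x : #|A| = t -> x \in A -> exists k : 'I_t, x = nth x0 (enum A) k.
Proof.
by move=> At; rewrite -mem_enum {1}(enum_nth_ord At) => /mapP[k _ ->]; exists k.
Qed.

Lemma nth_ord_inj A (j k : 'I_t) :
  #|A| = t -> nth x0 (enum A) j = nth x0 (enum A) k -> j = k.
Proof.
move=> At /eqP; rewrite nth_uniq ?enum_uniq -?cardE ?At // => /eqP.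
exact: val_inj.
Qed.

Lemma nth_ord_in A (k : 'I_t) : #|A| = t -> nth x0 (enum A) k \in A.
Proof. by move=> At; rewrite -mem_enum mem_nth // -cardE At. Qed.

Lemma mk_pmapE A B p (k : 'I_t) : #|A| = t ->
  mk_pmap A B p (nth x0 (enum A) k) = Some (nth x0 (enum B) (p k)).
Proof.
move=> At; rewrite ffunE; case: pickP => [j /eqP/(nth_ord_inj At) -> //|].
by move/(_ k); rewrite eqxx.
Qed.

Lemma mk_pmap_dom A B p : #|A| = t -> pdom (mk_pmap A B p) = A.
Proof.
move=> At; apply/setP => x; rewrite inE.
have [xA|xA] := boolP (x \in A).
  by have [k ->] := mem_nth_ord At xA; rewrite mk_pmapE.
rewrite ffunE; case: pickP => // k /eqP eq_x.
by rewrite -eq_x nth_ord_in in xA.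
Qed.

Lemma mk_pmap_sym_inv A B p : #|A| = t -> #|B| = t -> mk_pmap A B p \in sym_inv n.
Proof.
move=> At Bt; rewrite inE mk_pmap_dom //.
apply/forall_inP => x /(mem_nth_ord At)[j ->]; apply/forall_inP => y /(mem_nth_ord At)[k ->].
rewrite !mk_pmapE //; apply/implyP => /eqP[/(nth_ord_inj Bt)/perm_inj ->].
exact: eqxx.
Qed.

Lemma mk_pmap_images A B p : #|A| = t ->
  images (mk_pmap A B p) = [seq val (nth x0 (enum B) j) | j <- perm_word p].
Proof.
move=> At; rewrite /images mk_pmap_dom // (enum_nth_ord At) /perm_word.
by elim: (enum 'I_t) => //= k l IH; rewrite mk_pmapE //= IH.
Qed.

(** The enumeration of [B] is increasing, so the images compare exactly as the letters of
    [perm_word p]. *)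
Lemma mk_pmap_oriented A B p : #|A| = t -> #|B| = t ->
  oriented (mk_pmap A B p) = (p \in dihedral t).
Proof.
move=> At Bt; rewrite -oriented_word_perm.
rewrite /oriented /orientation_preserving /orientation_reversing mk_pmap_images //.
have mono : {in perm_word p &, {mono (fun j => val (nth x0 (enum B) j)) : x y / x < y}}.
  by move=> x y; rewrite !mem_perm_word !mem_iota /= -Bt => *; apply: nth_enum_ltn.
rewrite (@cyclic_count_map _ (fun x y => y < x)); last by move=> x y xs ys; exact: mono.
by rewrite (@cyclic_count_map _ (fun x y => x < y)).
Qed.

Lemma mk_pmap_inj A B p A' B' p' :
  #|A| = t -> #|B| = t -> #|A'| = t -> #|B'| = t ->
  mk_pmap A B p = mk_pmap A' B' p' -> [/\ A = A', B = B' & p = p'].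
Proof.
move=> At Bt At' Bt' eq_mk.
have eqA : A = A' by rewrite -(mk_pmap_dom B p At) eq_mk mk_pmap_dom.
subst A'.
have eqk k : nth x0 (enum B) (p k) = nth x0 (enum B') (p' k).
  by have := mk_pmapE B p k At; rewrite eq_mk mk_pmapE // => -[].
have eqB : B = B'.
  apply/eqP; rewrite eqEcard Bt Bt' leqnn andbT; apply/subsetP => y /(mem_nth_ord Bt)[k ->].
  by rewrite -(permKV p k) eqk nth_ord_in.
subst B'; split=> //; apply/permP => k; exact: nth_ord_inj Bt (eqk k).
Qed.

Lemma mk_pmap_surj (a : pmap_on n) : a \in sym_inv n -> #|pdom a| = t ->
  exists A B p, [/\ #|A| = t, #|B| = t & a = mk_pmap A B p].
Proof.
move=> a_inj At; pose A := pdom a; have [g g_inj aE] := sym_inv_fun x0 a_inj.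
pose B := g @: A; have Bt : #|B| = t by rewrite card_in_imset.
(* The induced permutation sends [k] to the position in [B] of the image of the k-th element of
   [A]. *)
have lt_f (k : 'I_t) : index (g (nth x0 (enum A) k)) (enum B) < t.
  by rewrite -[ltnRHS]Bt cardE index_mem mem_enum imset_f // nth_ord_in.
pose f k := Ordinal (lt_f k).
have fE k : nth x0 (enum B) (f k) = g (nth x0 (enum A) k).
  by rewrite nth_index // mem_enum imset_f // nth_ord_in.
have f_inj : injective f.
  move=> j k eq_f; apply: (nth_ord_inj At); apply: g_inj; rewrite ?nth_ord_in //.
  by rewrite -!fE eq_f.
exists A, B, (perm f_inj); split=> //; apply/ffunP => x.
have [xA|xA] := boolP (x \in A).
  by have [k ->] := mem_nth_ord At xA; rewrite mk_pmapE // permE fE aE ?nth_ord_in.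
have : x \notin pdom (mk_pmap A B (perm f_inj)) by rewrite mk_pmap_dom.
by move: xA; rewrite !inE !negbK => /eqP -> /eqP ->.
Qed.

(** [P] is left free so that one bijection serves every rank: it is trivial in low rank and
    membership in [alt_inv n] in the top two. *)
Lemma card_sym_inv_rank (P : pred (pmap_on n)) :
  #|[set a in sym_inv n | [&& #|pdom a| == t, oriented a & P a]]| =
  #|[set u : {set 'I_n} * {set 'I_n} * 'S_t |
      [&& #|u.1.1| == t, #|u.1.2| == t, u.2 \in dihedral t & P (mk_pmap u.1.1 u.1.2 u.2)]]|.
Proof.
rewrite -[RHS](@card_in_imset _ _ (fun u => mk_pmap u.1.1 u.1.2 u.2)).
  apply: eq_card => a; apply/idP/imsetP => [|[[[A B] p]]]; last first.
    move=> uS ->; rewrite in_set in uS; case/and4P: uS => /= /eqP At /eqP Bt pD Pu.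
    by rewrite in_set mk_pmap_sym_inv // mk_pmap_dom // mk_pmap_oriented // At eqxx pD.
  rewrite in_set => /and4P[a_inj /eqP At].
  have [A [B [p [At' Bt' ->]]]] := mk_pmap_surj a_inj At.
  rewrite mk_pmap_oriented // => pD Pu; exists (A, B, p) => //.
  by rewrite in_set /= At' Bt' eqxx pD.
move=> [[A B] p] [[A' B'] p'] uS vS.
rewrite in_set in uS; rewrite in_set in vS; move: uS vS => /=.
move=> /and4P[/eqP At /eqP Bt _ _] /and4P[/eqP At' /eqP Bt' _ _].
by case/(mk_pmap_inj At Bt At' Bt') => -> -> ->.
Qed.

End MakePmap.

(** * Extensions to permutations of the whole chain and their parity *)

Definition extends (n : nat) (s : 'S_n) (a : pmap_on n) :=
  {in pdom a, forall x, a x = Some (s x)}.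

Lemma alt_invP (n : nat) (a : pmap_on n) : a \in sym_inv n ->
  reflect (exists2 s : 'S_n, ~~ odd_perm s & extends s a) (a \in alt_inv n).
Proof.
move=> a_inj; rewrite inE a_inj; apply: (iffP existsP) => [[s]|[s s_even sa]].
  by move=> /andP[s_even /forall_inP sa]; exists s => // x /sa/eqP.
by exists s; rewrite s_even; apply/forall_inP => x /sa ->.
Qed.

(** List the domain followed by its complement, and the images followed by the complement of the
    image; matching positions gives the permutation. *)
Lemma exists_extends (n : nat) (a : pmap_on n) :
  a \in sym_inv n -> exists s : 'S_n, extends s a.
Proof.
case: n a => [|n] a a_inj; first by exists 1%g => -[].
have [g g_inj aE] := sym_inv_fun ord0 a_inj; set A := pdom a in g_inj aE *.
pose u := enum A ++ enum (~: A); pose v := map g (enum A) ++ enum (~: (g @: A)).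
have u_mem x : x \in u by rewrite mem_cat !mem_enum in_setC orbN.
have size_u : size u = n.+1 by rewrite size_cat -!cardE cardsC card_ord.
have size_v : size v = n.+1.
  by rewrite size_cat size_map -!cardE -(card_in_imset g_inj) cardsC card_ord.
have v_uniq : uniq v.
  rewrite cat_uniq enum_uniq andbT map_inj_in_uniq ?enum_uniq /=; last first.
    by move=> x y; rewrite !mem_enum; exact: g_inj.
  apply/hasPn => x; rewrite mem_enum in_setC; apply: contra => /mapP[y].
  by rewrite mem_enum => yA ->; exact: imset_f.
have lt_u x : index x u < size v by rewrite size_v -[ltnRHS]size_u index_mem.
pose f x := nth ord0 v (index x u).
have f_inj : injective f.
  move=> x y /eqP; rewrite nth_uniq ?lt_u // => /eqP.
  by apply: (index_inj ord0).
exists (perm f_inj) => x xA; rewrite permE /f /u index_cat mem_enum xA aE //.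
have lt_x : index x (enum A) < size (enum A) by rewrite index_mem mem_enum.
by rewrite /v nth_cat size_map lt_x (nth_map ord0) // nth_index // mem_enum.
Qed.

Lemma alt_inv_small (n : nat) (a : pmap_on n) :
  a \in sym_inv n -> #|pdom a|.+1 < n -> a \in alt_inv n.
Proof.
move=> a_inj a_small; have [s sa] := exists_extends a_inj.
have : 1 < #|~: pdom a| by move: (cardsC (pdom a)); rewrite card_ord; lia.
case/card_gt1P=> x [y [xA yA neq_xy]]; rewrite !in_setC in xA yA.
apply/alt_invP => //; have [s_odd|s_even] := boolP (odd_perm s); last by exists s.
(* The transposition acts first and moves only points outside the domain. *)
exists (tperm x y * s)%g; first by rewrite odd_permM odd_tperm neq_xy s_odd.
move=> z zA; rewrite permM tpermD ?sa //.
  by apply: contraNneq xA => ->.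
by apply: contraNneq yA => ->.
Qed.

Lemma extends_uniq (n : nat) (a : pmap_on n) (s s' : 'S_n) :
  n <= #|pdom a|.+1 -> extends s a -> extends s' a -> s = s'.
Proof.
move=> a_big sa s'a; have eq_in x : x \in pdom a -> s x = s' x.
  by move=> xA; apply: Some_inj; rewrite -sa // s'a.
apply/permP => x; have [xA|xA] := boolP (x \in pdom a); first exact: eq_in.
have C1 : #|~: pdom a| <= 1 by move: (cardsC (pdom a)); rewrite card_ord; lia.
(* Were [y] in the domain, injectivity of [s] would give [y = x]; hence both lie in a complement of
   at most one point. *)
pose y := (s'^-1 (s x))%g; have s'y : s' y = s x by rewrite permKV.
have [yA|yA] := boolP (y \in pdom a).
  by move: s'y; rewrite -eq_in // => /perm_inj y_x; rewrite -y_x yA in xA.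
have y_x : y = x by apply: (card_le1_eqP C1); rewrite in_setC.
by rewrite -s'y y_x.
Qed.

Lemma alt_inv_big (n : nat) (a : pmap_on n) (s : 'S_n) : a \in sym_inv n ->
  n <= #|pdom a|.+1 -> extends s a -> (a \in alt_inv n) = ~~ odd_perm s.
Proof.
move=> a_inj a_big sa; apply/alt_invP/idP => // [[s' s'_even s'a]|].
  by rewrite (extends_uniq a_big sa s'a).
by exists s.
Qed.

(** * Counting rank by rank *)

Definition AOR_rank (n t : nat) : {set pmap_on n} :=
  [set a in sym_inv n | [&& #|pdom a| == t, oriented a & a \in alt_inv n]].

Lemma card_AOR_ranks (n : nat) : #|AOR n| = \sum_(t < n.+1) #|AOR_rank n t|.
Proof.
have -> : \sum_(t < n.+1) #|AOR_rank n t| =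
    \sum_(t < n.+1) \sum_(a in AOR n) (#|pdom a| == t).
  apply: eq_bigr => t _; rewrite -sum1_card big_mkcond [RHS]big_mkcond.
  apply: eq_bigr => a _; rewrite /AOR /AOR_rank /alt_inv !inE.
  by case: [forall _ in _, _]; case: (_ == _); case: (oriented a); case: [exists _, _].
rewrite exchange_big /= -sum1_card; apply: eq_bigr => a _.
have lt_a : #|pdom a| < n.+1 by rewrite ltnS -[leqRHS]card_ord max_card.
rewrite (bigD1 (Ordinal lt_a)) //= eqxx big1 // => i.
by rewrite -val_eqE /= eq_sym => /negbTE ->.
Qed.

Lemma card_AOR_rank_small (n t : nat) : t.+1 < n ->
  #|AOR_rank n t| = 'C(n, t) ^ 2 * #|dihedral t|.
Proof.
move=> lt_tn; have x0 : 'I_n := Ordinal (ltn_trans (ltn0Sn t) lt_tn).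
transitivity #|[set a in sym_inv n | [&& #|pdom a| == t, oriented a & xpredT a]]|.
  apply: eq_card => a; rewrite [LHS]in_set [RHS]in_set andbT.
  have [a_inj|//] := boolP (a \in sym_inv n); case: eqP => //= a_t.
  by rewrite (alt_inv_small a_inj) ?a_t ?andbT.
rewrite (card_sym_inv_rank t x0).
pose D := [set A : {set 'I_n} | #|A| == t].
transitivity #|setX (setX D D) (dihedral t)|.
  by apply: eq_card => -[[A B] p]; rewrite !in_setX !in_set /= andbT andbA.
by rewrite !cardsX card_draws card_ord mulnn.
Qed.

(** Domain and image are the full set, so the map is [p] itself and the parity of [p] decides. *)
Lemma card_AOR_rank_full (n : nat) : 2 < n ->
  #|AOR_rank n n| = #|[set p in dihedral n | ~~ odd_perm p]|.
Proof.
move=> n_gt2; have x0 : 'I_n := Ordinal (ltn_trans (ltn0Sn 1) n_gt2).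
rewrite /AOR_rank (card_sym_inv_rank n x0 (mem (alt_inv n))).
have T_n : #|[set: 'I_n]| = n by rewrite cardsT card_ord.
have nthT (k : 'I_n) : nth x0 (enum [set: 'I_n]) k = k.
  by rewrite enum_setT -enumT nth_ord_enum.
have alt_p (p : 'S_n) : (mk_pmap x0 setT setT p \in alt_inv n) = ~~ odd_perm p.
  rewrite (@alt_inv_big _ _ p) ?mk_pmap_sym_inv ?mk_pmap_dom ?T_n // => x _.
  by rewrite -{1}(nthT x) mk_pmapE // nthT.
rewrite -(card_imset _ (_ : injective (fun p : 'S_n => ([set: 'I_n], [set: 'I_n], p)))); last first.
  by move=> p q [].
apply: eq_card => -[[A B] p]; rewrite in_set /=.
apply/and4P/imsetP => [[At Bt pD]|[q + [-> -> ->]]].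
  have full (C : {set 'I_n}) : #|C| == n -> C = [set: 'I_n].
    by move=> /eqP Cn; apply/eqP; rewrite eqEcard subsetT T_n Cn leqnn.
  rewrite (full A At) (full B Bt) => p_alt; exists p => //.
  by rewrite in_set pD -alt_p.
rewrite in_set => /andP[qD]; rewrite -alt_p => q_alt.
by split; rewrite ?T_n.
Qed.

(** Domain and image are complements of points [i] and [j], and the unique extension is
    [lift_perm i j p]. *)
Lemma card_AOR_rank_pred (n : nat) : 1 < n ->
  2 * #|AOR_rank n.+1 n| = n.+1 ^ 2 * #|dihedral n|.
Proof.
move=> n_gt1.
have C_n (i : 'I_n.+1) : #|~: [set i]| = n by rewrite cardsC1 card_ord.
(* [lift i] is the increasing enumeration of the complement of [i]. *)
have nthC x0 (i : 'I_n.+1) (k : 'I_n) : nth x0 (enum (~: [set i])) k = lift i k.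
  have -> : enum (~: [set i]) = [seq lift i k | k <- enum 'I_n].
    apply: (@irr_sorted_eq _ (relpre val ltn)) => [x y z|x|||x].
    - exact: ltn_trans.
    - exact: ltnn.
    - by rewrite -sorted_map enum_ord_ltn_sorted.
    - rewrite sorted_map; have := iota_ltn_sorted 0 n.
      rewrite -val_enum_ord sorted_map; apply: sub_sorted => x y /=.
      by rewrite /bump; lia.
    rewrite mem_enum !inE; apply/idP/mapP => [|[y _ ->]]; last by rewrite eq_sym neq_lift.
    by case: (unliftP i x) => [y -> _|->]; [exists y; rewrite ?mem_enum | rewrite eqxx].
  by rewrite (nth_map k) ?size_enum_ord // nth_ord_enum.
have alt_p x0 i j p :
    (mk_pmap x0 (~: [set i]) (~: [set j]) p \in alt_inv n.+1) = ~~ odd_perm (lift_perm i j p).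
  rewrite (@alt_inv_big _ _ (lift_perm i j p)) ?mk_pmap_sym_inv ?mk_pmap_dom ?C_n // => x.
  rewrite mk_pmap_dom ?C_n // => /(mem_nth_ord x0 (C_n i))[k ->].
  by rewrite mk_pmapE ?C_n // !nthC lift_perm_lift.
pose X := setX (setX [set: 'I_n.+1] [set: 'I_n.+1]) (dihedral n).
pose b (u : 'I_n.+1 * 'I_n.+1 * 'S_n) := ~~ odd_perm (lift_perm u.1.1 u.1.2 u.2).
have -> : #|AOR_rank n.+1 n| = #|[set u in X | b u]|.
  rewrite /AOR_rank (card_sym_inv_rank n ord0 (mem (alt_inv n.+1))).
  pose c (u : 'I_n.+1 * 'I_n.+1 * 'S_n) := (~: [set u.1.1], ~: [set u.1.2], u.2).
  have c_inj : injective c.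
    by move=> [[i j] p] [[i' j'] p'] [/setC_inj/set1_inj -> /setC_inj/set1_inj -> ->].
  rewrite -(card_imset _ c_inj).
  apply: eq_card => -[[A B] p]; rewrite in_set /=.
  apply/and4P/imsetP => [[At Bt pD]|[[[i j] q] + [-> -> ->]]].
    have co1 (C : {set 'I_n.+1}) : #|C| == n -> exists i, C = ~: [set i].
      move=> /eqP Cn; have /eqP/cards1P[i Ci] : #|~: C| = 1.
        by move: (cardsC C); rewrite card_ord; lia.
      by exists i; rewrite -Ci setCK.
    have [i ->] := co1 A At; have [j ->] := co1 B Bt => p_alt; exists (i, j, p) => //.
    by rewrite in_set !in_setX !in_setT pD /b /= -(alt_p ord0).
  rewrite in_set in_setX => /andP[/andP[_ qD]]; rewrite /b /= -(alt_p ord0) => q_alt.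
  by split; rewrite ?C_n.
have -> : n.+1 ^ 2 * #|dihedral n| = #|X| by rewrite !cardsX !cardsT card_ord mulnn.
(* Here [n] is the rank: [rev_ord] sends [i] to [n - i], which flips the parity of [i] when [n] is
   odd. *)
have [n_odd|n_even] := boolP (odd n).
  apply: (@card_sign_halves _ _ _ (fun u => (rev_ord u.1.1, u.1.2, u.2))).
  - by apply: inv_inj => -[[i j] p] /=; rewrite rev_ordK.
  - by move=> [[i j] p]; rewrite !in_setX !in_setT.
  move=> [[i j] p] _; rewrite /b /= !odd_lift_perm /= subSS oddB ?n_odd; last by rewrite -ltnS.
  by case: (odd i); case: (odd j); case: (odd_perm p).
(* For even [n] the rotation is an odd permutation. *)
apply: (@card_sign_halves _ _ _ (fun u => (u.1.1, u.1.2, (rotation n * u.2)%g))).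
- by move=> [[i j] p] [[i' j'] p'] [-> -> /mulgI ->].
- by move=> [[i j] p]; rewrite !in_setX /= => /andP[-> /mulg_rotation_dihedral].
move=> [[i j] p] _; rewrite /b /= !odd_lift_perm odd_permM odd_rotation ?n_even; last lia.
by case: (odd i); case: (odd j); case: (odd_perm p).
Qed.

(** * Evaluation of the sum over ranks *)

(** Replacing one of the two copies of [t] by [n - t], by symmetry, makes the weight the constant
    [n]; Vandermonde's identity does the rest. *)
Lemma sum_index_bin_sqr (n : nat) :
  \sum_(t < n.+1) 'C(n, t) ^ 2 * (2 * t) = n * 'C(2 * n, n).
Proof.
have rev_sum : \sum_(t < n.+1) 'C(n, t) ^ 2 * t = \sum_(t < n.+1) 'C(n, t) ^ 2 * (n - t).
  rewrite (reindex_inj rev_ord_inj) /=; apply: eq_bigr => t _.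
  by rewrite subSS bin_sub // -ltnS.
transitivity (\sum_(t < n.+1) 'C(n, t) ^ 2 * t + \sum_(t < n.+1) 'C(n, t) ^ 2 * (n - t)).
  by rewrite -rev_sum -big_split; apply: eq_bigr => t _ /=; rewrite mulnCA mul2n addnn.
rewrite mul2n -addnn -binomial.Vandermonde big_distrr -big_split /=.
apply: eq_bigr => t _; have le_tn : t <= n by rewrite -ltnS.
by rewrite -mulnDr subnKC // bin_sub // mulnC mulnn.
Qed.

(* The correction terms come from the ranks 0, 1, 2, where #|dihedral t| = t`!
   differs from 2 * t. *)
Lemma sum_bin_sqr_dihedral (n k : nat) : 2 < k ->
  \sum_(t < k) 'C(n, t) ^ 2 * #|dihedral t| + n ^ 2 + 2 * 'C(n, 2) ^ 2 =
  (\sum_(t < k) 'C(n, t) ^ 2 * (2 * t)).+1.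
Proof.
elim: k => // k IH; rewrite ltnS leq_eqVlt => /predU1P[<-|k_gt2].
  rewrite !big_ord_recr !big_ord0 /= !card_dihedral_small // bin0 bin1.
  by rewrite !factS fact0; lia.
by rewrite !big_ord_recr /= card_dihedral // -addSn -(IH k_gt2); ring.
Qed.

Unset Implicit Arguments.
Local Open Scope ring_scope.

Theorem proposition2p2 (n : nat) (hn : (4 <= n)%N) :
  (#|AOR n|%:R : rat) =
    if (n %% 4 == 1)%N
    then 1 + n%:R * 'C(2 * n, n)%:R - n%:R ^+ 2 * (n%:R ^+ 2 + 1) / 2
    else 1 + n%:R * 'C(2 * n, n)%:R - n%:R ^+ 2 * (n%:R ^+ 2 + 1) / 2 - n%:R.
Proof.
case: n hn => // m hm; set n := m.+1.
set Y := #|AOR_rank n m|; set Z := #|AOR_rank n n|.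
set X := (\sum_(t < m) 'C(n, t) ^ 2 * #|dihedral t|)%N.
set T := (\sum_(t < m) 'C(n, t) ^ 2 * (2 * t))%N.
have total : (#|AOR n| = X + Y + Z)%N.
  rewrite card_AOR_ranks !big_ord_recr /=; congr (_ + _ + _)%N.
  by apply: eq_bigr => t _; rewrite card_AOR_rank_small // !ltnS.
(* The side condition [2 < m] is [4 <= n]: the ranks 0, 1, 2 all lie below [m]. *)
have low : (X + n ^ 2 + 2 * 'C(n, 2) ^ 2 = T.+1)%N by exact: sum_bin_sqr_dihedral.
(* The two split-off terms are those of ranks [m] and [n], with binomials [n] and 1. *)
have sumT : (T + n ^ 2 * (2 * m) + 2 * n = n * 'C(2 * n, n))%N.
  rewrite -sum_index_bin_sqr !big_ord_recr /= binn.
  by rewrite -(bin_sub (leqnSn m)) subSnn bin1 mul1n.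
have Yval : (Y = n ^ 2 * m)%N.
  apply/eqP; rewrite -(eqn_pmul2l (isT : (0 < 2)%N)) card_AOR_rank_pred ?card_dihedral //.
    by rewrite mulnCA.
  exact: ltnW.
have Zval : Z = if (n %% 4 == 1)%N then (2 * n)%N else n.
  by rewrite /Z card_AOR_rank_full ?card_even_dihedral // ltnW.
(* Doubling the binomial avoids division; the square is the form that occurs in [low]. *)
have Cval : ((2 * 'C(n, 2)) ^ 2 = (n * m) ^ 2)%N.
  by rewrite mul_bin_left bin1 subSS subn0 mulnC.
have nE : n%:R = m%:R + 1 :> rat by rewrite natr1.
clearbody X Y Z T n.
have toQ (a b : nat) : a = b -> a%:R = b%:R :> rat by move=> ->.
move/toQ: total => ->; move/toQ: low; move/toQ: sumT; move/toQ: Yval; move/toQ: Cval.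
rewrite Zval -natr1 !natrD !(natrX, natrM) nE => Cval Yval sumT low.
(* Expanded in [m], the collected equations yield the goal by linear combination. *)
by case: ifP => _; rewrite ?natrM nE; lra.
Qed.
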